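(* Let $G=(V,E)$ be a (possibly nonconnected) nonempty graph, that is, a graph with at least one edge, and let $\Omega$ be a verification operator of the graph state $|G\rangle$ based on $X$ and $Z$ measurements. Then the spectral gap satisfies $\nu(\Omega)\leq 1/2$. To saturate this upper bound, $X$ and $Z$ should be measured with an equal probability for each qubit; that is, if $\nu(\Omega)=1/2$, then for every qubit $j\in V$ the probability that $X$ is measured on qubit $j$ equals the probability that $Z$ is measured on qubit $j$.
   Context: Graphs are finite and simple, with vertex set $V=\{1,\dots,n\}$. The graph state $|G\rangle\in(\mathbb{C}^2)^{\otimes n}$ is the unique (up to phase) unit vector that is a common $+1$ eigenvector of $S_j=X_j\prod_{k:\{j,k\}\in E}Z_k$, $j=1,\dots,n$, with $X_j,Z_j$ the Pauli matrices acting on qubit $j$. A test operator for $|G\rangle$ is an operator $E$ with $0\le E\le \mathbb{1}$ and $E|G\rangle=|G\rangle$; a verification operator is a finite convex combination $\Omega=\sum_kp_kE_k$ of test operators ($p_k\ge 0$, $\sum_kp_k=1$), where $p_k$ is the probability of performing the $k$th test. $\beta(\Omega)$ is the second largest eigenvalue of $\Omega$ (counted with multiplicity; the largest is $1$, attained at $|G\rangle$), and $\nu(\Omega)=1-\beta(\Omega)$ is the spectral gap. $\Omega=\sum_kp_kE_k$ is based on $X$ and $Z$ measurements if each $E_k$ is associated with a measurement setting $\mu_k$ in which the only nontrivial measurements performed on individual qubits are $X$ and $Z$ measurements, and $E_k$ is a linear combination of the outcome projectors of $\mu_k$, i.e., of the tensor products over the qubits of eigenprojectors of the measured single-qubit Pauli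 operators (the identity on a qubit that is not measured). The probability that $X$ (respectively $Z$) is measured on qubit $j$ is the sum of $p_k$ over those $k$ for which $\mu_k$ measures $X$ (respectively $Z$) on qubit $j$.
   Formalization: The equality of the X and Z probabilities when the gap is 1/2 is proved only for qubits j that have at least one neighbour; for an isolated vertex it is false (one edge plus an isolated qubit on which X is always measured). *)

(* Defs.v *)
From mathcomp Require Import all_boot all_order all_algebra.
From mathcomp Require Import reals complex.

Set Implicit Arguments.
Unset Strict Implicit.
Unset Printing Implicit Defensive.

Import Order.TTheory GRing.Theory Num.Theory.

Local Open Scope ring_scope.
Local Open Scope sesquilinear_scope.

(* (C^2)^{\otimes n} is the space of column vectors whose coordinates are
   indexed by the bit strings of length n, enumerated by [enum_val]. *)
Notation bits n := {ffun 'I_n -> 'I_2}.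
Notation qdim n := #|{: bits n}|.

(* The tensor product of the one-qubit operators A j, in the computational
   basis: its (x, y) entry is the product of the entries (A j)_(x_j, y_j). *)
Definition tensor (C : numClosedFieldType) n (A : 'I_n -> 'M[C]_2)
    : 'M[C]_(qdim n) :=
  \matrix_(x, y) \prod_(j < n)
     A j ((enum_val x : bits n) j) ((enum_val y : bits n) j).

Definition pauliX (C : numClosedFieldType) : 'M[C]_2 :=
  \matrix_(a, b) (a != b)%:R.

Definition pauliZ (C : numClosedFieldType) : 'M[C]_2 :=
  \matrix_(a, b) ((-1) ^+ a *+ (a == b)).

Definition on_qubit (C : numClosedFieldType) n (j : 'I_n) (A : 'M[C]_2)
    : 'M[C]_(qdim n) :=
  tensor (fun i => if i == j then A else 1%:M).

Definition graph_stabilizer (C : numClosedFieldType) n (e : rel 'I_n)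
    (j : 'I_n) : 'M[C]_(qdim n) :=
  on_qubit j (pauliX C) *m
  \big[mulmx/1%:M]_(k < n | e j k) on_qubit k (pauliZ C).

(* The graph state is unique only up to a phase, hence a predicate. *)
Definition graph_state (C : numClosedFieldType) n (e : rel 'I_n)
    (psi : 'cV[C]_(qdim n)) : Prop :=
  psi ^t* *m psi = 1%:M /\
  forall j, graph_stabilizer C e j *m psi = psi.

(* In a numClosedFieldType, 0 <= z means that z is real and nonnegative. *)
Definition psdmx (C : numClosedFieldType) d (A : 'M[C]_d) : Prop :=
  A \is hermsymmx /\ forall v : 'cV[C]_d, 0 <= (v ^t* *m A *m v) 0 0.

Definition test_operator (C : numClosedFieldType) d (psi : 'cV[C]_d)
    (E : 'M[C]_d) : Prop :=
  [/\ psdmx E, psdmx (1%:M - E) & E *m psi = psi].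

Definition prob_weights (C : numClosedFieldType) m (p : 'I_m -> C) : Prop :=
  (forall k, 0 <= p k) /\ \sum_(k < m) p k = 1.

Variant xz_meas := MeasX | MeasZ | NoMeas.

Definition measuresX (s : xz_meas) : bool :=
  if s is MeasX then true else false.

Definition measuresZ (s : xz_meas) : bool :=
  if s is MeasZ then true else false.

(* Eigenprojector of the measured Pauli operator for the eigenvalue (-1)^b;
   the outcome b is a dummy on a qubit that is not measured. *)
Definition outcome_proj1 (C : numClosedFieldType) (s : xz_meas) (b : bool)
    : 'M[C]_2 :=
  match s with
  | MeasX => 2%:R^-1 *: (1%:M + (-1) ^+ b *: pauliX C)
  | MeasZ => 2%:R^-1 *: (1%:M + (-1) ^+ b *: pauliZ C)
  | NoMeas => 1%:M
  end.

Definition outcome_proj (C : numClosedFieldType) n (mu : 'I_n -> xz_meas)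
    (o : {ffun 'I_n -> bool}) : 'M[C]_(qdim n) :=
  tensor (fun j => outcome_proj1 C (mu j) (o j)).

Definition associated_with (C : numClosedFieldType) n (mu : 'I_n -> xz_meas)
    (E : 'M[C]_(qdim n)) : Prop :=
  exists c : {ffun 'I_n -> bool} -> C,
    E = \sum_(o : {ffun 'I_n -> bool}) c o *: outcome_proj C mu o.

Definition xz_verification (C : numClosedFieldType) n
    (psi : 'cV[C]_(qdim n)) m (p : 'I_m -> C) (E : 'I_m -> 'M[C]_(qdim n))
    (mu : 'I_m -> 'I_n -> xz_meas) : Prop :=
  [/\ prob_weights p, forall k, test_operator psi (E k)
    & forall k, associated_with (mu k) (E k)].

Definition verification_operator (C : numClosedFieldType) d m (p : 'I_m -> C)
    (E : 'I_m -> 'M[C]_d) : 'M[C]_d :=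
  \sum_(k < m) p k *: E k.

Definition probX (C : numClosedFieldType) n m (p : 'I_m -> C)
    (mu : 'I_m -> 'I_n -> xz_meas) (j : 'I_n) : C :=
  \sum_(k < m | measuresX (mu k j)) p k.

Definition probZ (C : numClosedFieldType) n m (p : 'I_m -> C)
    (mu : 'I_m -> 'I_n -> xz_meas) (j : 'I_n) : C :=
  \sum_(k < m | measuresZ (mu k j)) p k.

(* The eigenvalues listed with multiplicity, as the roots of the
   characteristic polynomial. *)
Definition spectrum (C : numClosedFieldType) d (A : 'M[C]_d) : seq C :=
  sval (closed_field_poly_normal (char_poly A)).

(* The order on C is partial, but it is total on the spectrum of a Hermitian
   matrix, which is the only case in which the sorted list is meaningful. *)
Definition second_eigenvalue (C : numClosedFieldType) d (A : 'M[C]_d) : C :=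
  nth 0 (sort (fun x y => y <= x) (spectrum A)) 1.

Definition spectral_gap (C : numClosedFieldType) d (A : 'M[C]_d) : C :=
  1 - second_eigenvalue A.

(* Main.v *)
(* If X (resp. Z) is not measured on qubit j, then the test commutes with Z_j
   (resp. X_j), hence Z_j psi (resp. X_j psi) passes it with certainty. When j
   has a neighbour, both vectors are orthogonal to psi, because Z_j and X_j
   anticommute with the stabilizer generator of j and of the neighbour. So the
   gap is at most the probability of measuring X on j, and at most that of
   measuring Z on j, while these probabilities sum to at most 1. *)
Require Import Defs.
From mathcomp Require Import all_boot all_order all_algebra.
From mathcomp Require Import reals complex.

Set Implicit Arguments.
Unset Strict Implicit.
Unset Printing Implicit Defensive.

Import Order.TTheory GRing.Theory Num.Theory.
Local Open Scope ring_scope.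
Local Open Scope sesquilinear_scope.

(** * Hermitian spectra and a variational bound on the second eigenvalue *)

Lemma char_poly_similar (F : comUnitRingType) d (P A : 'M[F]_d) :
  P \in unitmx -> char_poly (invmx P *m A *m P) = char_poly A.
Proof.
move=> Pu; rewrite /char_poly /char_poly_mx.
pose Q := map_mx polyC P; pose Q' := map_mx polyC (invmx P).
have QQ : Q' *m Q = 1%:M by rewrite -map_mxM mulVmx // map_mx1.
have -> : 'X%:M - map_mx polyC (invmx P *m A *m P)
    = Q' *m ('X%:M - map_mx polyC A) *m Q.
  rewrite !map_mxM mulmxBr mulmxBl; congr (_ - _).
  by rewrite mul_mx_scalar -scalemxAl QQ scalemx1.
by rewrite !det_mulmx mulrC mulrA -det_mulmx (mulmx1C QQ) det1 mul1r.
Qed.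

Section Spectrum.
Variable C : numClosedFieldType.

Lemma adjoint_mul m n p (A : 'M[C]_(m, n)) (B : 'M[C]_(n, p)) :
  (A *m B) ^t* = B ^t* *m A ^t*.
Proof. by rewrite trmx_mul map_mxM. Qed.

Lemma adjointK m n (A : 'M[C]_(m, n)) : (A ^t*) ^t* = A.
Proof. by apply/matrixP=> i j; rewrite !mxE conjCK. Qed.

(** Links the polynomial roots behind [second_eigenvalue] to the diagonal given by the spectral
    theorem: similar matrices share their characteristic polynomial, and a split monic polynomial
    determines its roots with multiplicity. *)
Lemma spectrum_hermitian d (A : 'M[C]_d) : A \is hermsymmx ->
  perm_eq (spectrum A) (codom (fun i => spectral_diag A 0 i)).
Proof.
move=> /hermitian_normalmx /orthomx_spectralP A_eq.
rewrite /spectrum; case: closed_field_poly_normal => s /= s_eq.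
apply: prod_XsubC_eq; move: s_eq.
rewrite (monicP (char_poly_monic A)) scale1r => <-.
rewrite {1}A_eq char_poly_similar ?spectral_unit // char_poly_trig; last first.
  exact/is_diag_mx_is_trig/diag_mx_is_diag.
by rewrite codomE big_map enumT; apply: eq_bigr => i _; rewrite !mxE eqxx.
Qed.

Lemma normmxE d (u : 'cV[C]_d) : (u ^t* *m u) 0 0 = \sum_i `|u i 0| ^+ 2.
Proof. by rewrite mxE; apply: eq_bigr => i _; rewrite !mxE mulrC normCK. Qed.

(** Discarding one index rather than one value respects multiplicity: a degenerate top eigenvalue
    also occupies position 1 of the sorted list. *)
Lemma second_eigenvalue_max d (A : 'M[C]_d) : (1 < d)%N -> A \is hermsymmx ->
  exists i0, forall i, i != i0 -> spectral_diag A 0 i <= second_eigenvalue A.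
Proof.
move=> d_gt1 hA; have pe := spectrum_hermitian hA.
set D := fun i => spectral_diag A 0 i in pe *.
have Dreal i : D i \is Num.real.
  exact: (mxOverP (hermitian_spectral_diag_real hA)).
rewrite /second_eigenvalue; set q := sort _ _.
have pq : perm_eq q (codom D) by rewrite perm_sort.
(* The order is total only on reals, so sortedness of [q] needs real roots. *)
have q_real : all (mem Num.real) (spectrum A).
  by rewrite (perm_all _ pe); apply/allP => _ /codomP[i ->]; apply: Dreal.
have q_srt : sorted (fun x y : C => y <= x) q.
  apply: (sort_sorted_in _ q_real) => x y xr yr /=.
  exact: (real_leVge yr xr).
have := perm_size pq; rewrite size_codom card_ord; move: pq q_srt.
(* The list has [d] entries, so [1 < d] keeps [nth] away from its default value. *)
case: q => [|q0 [|q1 q]] /=.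
- by move=> _ _ d0; rewrite -d0 in d_gt1.
- by move=> _ _ d1; rewrite -d1 in d_gt1.
move=> pq /andP[_ q_path] _.
have q_min x : x \in q1 :: q -> x <= q1.
  rewrite inE => /predU1P[->//|xq].
  have tr : transitive (fun x y : C => y <= x).
    by move=> a b c ab ca; apply: le_trans ca ab.
  by have /allP/(_ x xq) := order_path_min tr q_path.
have /codomP[i0 q0E] : q0 \in codom D by rewrite -(perm_mem pq) mem_head.
exists i0 => i ni; apply: q_min.
(* Removing the index [i0] deletes exactly one copy of the head [q0]. *)
have pr : perm_eq (q1 :: q) [seq D j | j <- rem i0 (enum 'I_d)].
  rewrite -(perm_cons q0) (perm_trans pq) // q0E codomE -map_cons perm_map //.
  by apply: perm_to_rem; rewrite mem_enum.
by rewrite (perm_mem pr) map_f // mem_rem_uniq ?enum_uniq // !inE ni mem_enum.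
Qed.

(* Courant-Fischer on the span of psi and v: it contains a nonzero vector
   without component along the top eigenvector. *)
Lemma second_eigenvalue_ge d (A : 'M[C]_d) (psi v : 'cV[C]_d) (t : C) :
  (1 < d)%N -> A \is hermsymmx ->
  psi ^t* *m psi = 1%:M -> A *m psi = psi ->
  v ^t* *m v = 1%:M -> psi ^t* *m v = 0 ->
  t <= 1 -> t <= (v ^t* *m A *m v) 0 0 -> t <= second_eigenvalue A.
Proof.
move=> d_gt1 hA psi1 Apsi v1 psiv t_le1 t_le.
have [i0 i0P] := second_eigenvalue_max d_gt1 hA.
have A_eq := orthomx_spectralP (hermitian_normalmx hA).
set P := spectralmx A in A_eq; set D := spectral_diag A in A_eq i0P.
have Pu : P \is unitarymx by apply: spectral_unitarymx.
have PP : P ^t* *m P = 1%:M by apply/mulmx1C/unitarymxP.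
rewrite (invmx_unitary Pu) in A_eq.
have qE (w : 'cV_d) :
    (w ^t* *m A *m w) 0 0 = \sum_i D 0 i * `|(P *m w) i 0| ^+ 2.
  have -> : w ^t* *m A *m w = (P *m w) ^t* *m (diag_mx D *m (P *m w)).
    by rewrite A_eq adjoint_mul !mulmxA.
  move: (P *m w) => u; rewrite mxE; apply: eq_bigr => i _.
  by rewrite mul_diag_mx !mxE normCK mulrCA [_^* * _]mulrC.
have nE (w : 'cV_d) : (w ^t* *m w) 0 0 = \sum_i `|(P *m w) i 0| ^+ 2.
  by rewrite -(normmxE (P *m w)) adjoint_mul -mulmxA (mulmxA _ P) PP mul1mx.
(* A vanishing [i0] coordinate is one linear equation in [(a, b)]. If that coordinate of [psi] is
   zero, [psi] itself serves; otherwise the crossed coordinates solve it with [b] nonzero. *)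
have [a [b [ab0 Pw0]]] : exists a b : C, 0 < `|a| ^+ 2 + `|b| ^+ 2 /\
    (P *m (a *: psi + b *: v)) i0 0 = 0.
  have [p0|p0] := eqVneq ((P *m psi) i0 0) 0.
    exists 1, 0; rewrite normr1 normr0 expr1n expr0n addr0 ltr01.
    by rewrite scale1r scale0r addr0 p0.
  exists ((P *m v) i0 0), (- (P *m psi) i0 0); split.
    apply: ltr_wpDl; rewrite ?exprn_ge0 // exprn_gt0 //.
    by rewrite normr_gt0 oppr_eq0.
  rewrite mulmxDr -!scalemxAr.
  by move: (P *m v) (P *m psi) => x y; rewrite !mxE mulNr mulrC subrr.
set w := a *: psi + b *: v in Pw0.
have vpsi : v ^t* *m psi = 0.
  by rewrite -[psi]adjointK -adjoint_mul psiv trmx0 map_mx0.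
have psiA : psi ^t* *m A = psi ^t*.
  rewrite -{2}Apsi adjoint_mul; congr (_ *m _).
  by have /is_hermitianmxP := hA; rewrite expr0 scale1r.
have wE (B : 'M[C]_d) : w ^t* *m B *m w =
   (a * a^* ) *: (psi ^t* *m B *m psi) + (a^* * b) *: (psi ^t* *m B *m v)
   + ((b^* * a) *: (v ^t* *m B *m psi) + (b * b^* ) *: (v ^t* *m B *m v)).
  have -> : w ^t* = a^* *: psi ^t* + b^* *: v ^t*.
    by apply/matrixP => i j; rewrite !mxE rmorphD !rmorphM.
  rewrite /w !mulmxDl !mulmxDr -!scalemxAl -!scalemxAr !scalerA.
  by rewrite ![_ * (_^* )]mulrC.
have nw : (w ^t* *m w) 0 0 = `|a| ^+ 2 + `|b| ^+ 2.
  rewrite -[w ^t*]mulmx1 wE !mulmx1 psi1 v1 psiv vpsi !scaler0 addr0 add0r.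
  by rewrite !mxE eqxx !mulr1 !normCK.
(* The form has no cross terms on the span, as [psi] is fixed by the Hermitian [A] and orthogonal to
   [v]. Its diagonal values, 1 and the one at [v], are both at least [t]. *)
have Aw : t * (w ^t* *m w) 0 0 <= (w ^t* *m A *m w) 0 0.
  rewrite nw wE -(mulmxA (v ^t*) A psi) Apsi psiA psiv vpsi !scaler0 add0r.
  rewrite psi1 addr0; move: (v ^t* *m A *m v) t_le => r t_le.
  rewrite !mxE eqxx mulr1 -!normCK mulrDr ![t * _]mulrC.
  by rewrite lerD // ?ler_piMr ?ler_wpM2l ?exprn_ge0.
have wpos : 0 < (w ^t* *m w) 0 0 by rewrite nw.
(* In the eigenbasis the [i0] term vanishes, and every other eigenvalue is at most the second
   one. *)
rewrite -(ler_pM2r wpos) (le_trans Aw) // qE nE mulr_sumr.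
apply: ler_sum => i _; have [->|ni] := eqVneq i i0.
  by rewrite Pw0 normr0 expr0n !mulr0.
by rewrite ler_wpM2r ?exprn_ge0 ?i0P.
Qed.

End Spectrum.

(** * Tensor products of one-qubit operators and their commutation up to scalars *)

Section Tensor.
Variables (C : numClosedFieldType) (n : nat).
Implicit Types (A B : 'I_n -> 'M[C]_2).

Lemma eq_tensor A B : A =1 B -> tensor A = tensor B.
Proof.
move=> eqAB; apply/matrixP => x y; rewrite !mxE.
by apply: eq_bigr => j _; rewrite eqAB.
Qed.

Lemma tensor_mul A B : tensor A *m tensor B = tensor (fun j => A j *m B j).
Proof.
apply/matrixP => x z; rewrite !mxE.
under eq_bigr do rewrite !mxE -big_split /=.
under [RHS]eq_bigr do rewrite mxE.
set x' : bits n := enum_val x; set z' : bits n := enum_val z.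
(* Distributivity turns a product over qubits of sums over the middle bit into a sum over middle bit
   strings. *)
by rewrite bigA_distr_bigA /= (big_enum_val (A := {: bits n})
  (fun f : bits n => \prod_j (A j (x' j) (f j) * B j (f j) (z' j)))).
Qed.

Lemma tensorZ (c : 'I_n -> C) A :
  tensor (fun j => c j *: A j) = (\prod_j c j) *: tensor A.
Proof.
apply/matrixP => x y; rewrite !mxE -big_split /=.
by apply: eq_bigr => j _; rewrite mxE.
Qed.

Lemma tensor1 : tensor (fun=> 1%:M) = 1%:M :> 'M[C]_(qdim n).
Proof.
apply/matrixP => x y; rewrite !mxE; have [<-|nxy] := eqVneq x y.
  by apply: big1 => j _; rewrite mxE eqxx.
have /eqP/ffunP nf : (enum_val x : bits n) != enum_val y.
  by apply: contra nxy => /eqP /enum_val_inj ->.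
have [j nj] : exists j, (enum_val x : bits n) j != (enum_val y : bits n) j.
  apply/existsP; apply: contra_notT nf => /existsPn nf j.
  exact/eqP/negPn/nf.
by rewrite (bigD1 j) //= mxE (negPf nj) mul0r.
Qed.

Lemma tensor_adjoint A : (tensor A) ^t* = tensor (fun j => (A j) ^t*).
Proof.
apply/matrixP => x y; rewrite !mxE rmorph_prod.
by apply: eq_bigr => j _; rewrite !mxE.
Qed.

Lemma tensor_unitary A :
  (forall j, A j \is unitarymx) -> tensor A \is unitarymx.
Proof.
move=> Au; apply/unitarymxP; rewrite tensor_adjoint tensor_mul -tensor1.
by apply: eq_tensor => j; apply/unitarymxP.
Qed.

Lemma tensor_comm (c : 'I_n -> C) A B :
  (forall j, A j *m B j = c j *: (B j *m A j)) ->
  tensor A *m tensor B = (\prod_j c j) *: (tensor B *m tensor A).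
Proof. by move=> cAB; rewrite !tensor_mul -tensorZ; apply: eq_tensor. Qed.

Lemma on_qubit_unitary (j : 'I_n) (M : 'M[C]_2) :
  M \is unitarymx -> on_qubit j M \is unitarymx.
Proof.
move=> Mu; apply: tensor_unitary => i; case: eqP => // _.
by apply/unitarymxP; rewrite mul1mx trmx1 map_mx1.
Qed.

Lemma on_qubit_comm (j k : 'I_n) (c : C) (M N : 'M[C]_2) :
  M *m N = c *: (N *m M) ->
  on_qubit j M *m on_qubit k N =
  (if j == k then c else 1) *: (on_qubit k N *m on_qubit j M).
Proof.
move=> cMN.
(* The scalar arises only at position [j], and only if both operators act there; at any other
   position one factor is the identity. *)
rewrite (tensor_comm (c := fun i => if (i == j) && (j == k) then c else 1)).
  congr (_ *: _); rewrite (bigD1 j) //= eqxx big1 ?mulr1 //.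
  by move=> i /negPf ->.
move=> i; have [->|nij] := eqVneq i j.
  by have [_|_] := eqVneq j k; rewrite //= mulmx1 mul1mx scale1r.
by rewrite scale1r mulmx1 mul1mx.
Qed.

End Tensor.

(** * Pauli relations and outcome projectors *)

Section Pauli.
Variable C : numClosedFieldType.
Local Notation X := (pauliX C).
Local Notation Z := (pauliZ C).

Lemma pauliX_unitary : X \is unitarymx.
Proof.
apply/unitarymxP/matrixP => i j; rewrite !mxE !big_ord_recl big_ord0 !mxE.
by case: i j => [[|[|[]]]] // ? [[|[|[]]]] // ?;
  rewrite !rmorph_nat /= ?mul0r ?mulr0 ?mul1r ?addr0 ?add0r.
Qed.

Lemma pauliZ_unitary : Z \is unitarymx.
Proof.
apply/unitarymxP/matrixP => i j; rewrite !mxE !big_ord_recl big_ord0 !mxE.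
by case: i j => [[|[|[]]]] // ? [[|[|[]]]] // ?;
  rewrite !rmorphMn !rmorphXn !rmorphN1 /= ?mulr0n ?mulr1n ?expr0 ?expr1
    ?mulN1r ?mul0r ?mulr0 ?mul1r ?addr0 ?add0r ?opprK ?oppr0.
Qed.

Lemma pauliXZ_anticomm : X *m Z = -1 *: (Z *m X).
Proof.
apply/matrixP => i j; rewrite !mxE !big_ord_recl !big_ord0 !mxE.
by case: i j => [[|[|[]]]] // ? [[|[|[]]]] // ?;
  rewrite /= ?mulr0n ?mulr1n ?expr0 ?expr1
    ?mulN1r ?mul0r ?mulr0 ?mul1r ?mulr1 ?addr0 ?add0r ?opprK ?oppr0.
Qed.

Lemma pauliZX_anticomm : Z *m X = -1 *: (X *m Z).
Proof. by rewrite pauliXZ_anticomm scalerA mulN1r opprK scale1r. Qed.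

(** The remaining projectors are affine in [Z] or equal to the identity. *)
Lemma pauliZ_outcome s b : ~~ measuresX s -> comm_mx Z (outcome_proj1 C s b).
Proof.
rewrite /comm_mx; case: s => //= _; last by rewrite mulmx1 mul1mx.
rewrite -scalemxAr -scalemxAl mulmxDl mulmxDr mulmx1 mul1mx.
by rewrite -scalemxAr -scalemxAl.
Qed.

Lemma pauliX_outcome s b : ~~ measuresZ s -> comm_mx X (outcome_proj1 C s b).
Proof.
rewrite /comm_mx; case: s => //= _; last by rewrite mulmx1 mul1mx.
rewrite -scalemxAr -scalemxAl mulmxDl mulmxDr mulmx1 mul1mx.
by rewrite -scalemxAr -scalemxAl.
Qed.

End Pauli.

(** * Signs between Pauli operators and stabilizer generators *)

Lemma big_mulmx_comm (C : comPzRingType) d (I : Type) (r : seq I) (P : pred I)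
    (U : 'M[C]_d) (M : I -> 'M[C]_d) (c : I -> C) :
  (forall i, P i -> U *m M i = c i *: (M i *m U)) ->
  U *m \big[mulmx/1%:M]_(i <- r | P i) M i =
  (\prod_(i <- r | P i) c i) *: (\big[mulmx/1%:M]_(i <- r | P i) M i *m U).
Proof.
move=> cM; elim: r => [|i r IHr].
  by rewrite !big_nil scale1r mulmx1 mul1mx.
rewrite !big_cons; case: ifP => // Pi.
by rewrite mulmxA cM // -scalemxAl -mulmxA IHr -scalemxAr scalerA mulmxA.
Qed.

Section Stabilizer.
Variables (C : numClosedFieldType) (n : nat) (e : rel 'I_n).
Local Notation X := (pauliX C).
Local Notation Z := (pauliZ C).

Lemma graph_stabilizer_unitary j : graph_stabilizer C e j \is unitarymx.
Proof.
apply: mul_unitarymx; first exact/on_qubit_unitary/pauliX_unitary.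
apply: (big_ind (fun M => M \is unitarymx)).
- by apply/unitarymxP; rewrite mul1mx trmx1 map_mx1.
- by move=> ? ?; apply: mul_unitarymx.
- by move=> k _; apply/on_qubit_unitary/pauliZ_unitary.
Qed.

(** The only sign comes from the factor [X] on qubit [j]. *)
Lemma pauliZ_stabilizer (j : 'I_n) :
  on_qubit j Z *m graph_stabilizer C e j =
  -1 *: (graph_stabilizer C e j *m on_qubit j Z).
Proof.
rewrite mulmxA (on_qubit_comm j j (pauliZX_anticomm C)) eqxx -scalemxAl.
rewrite -!mulmxA; congr (_ *: (_ *m _)).
rewrite (big_mulmx_comm _ (c := fun=> 1)) ?big1 ?scale1r // => k _.
by rewrite (on_qubit_comm j k (c := 1)) ?if_same // scale1r.
Qed.

(** The only sign comes from the factor [Z] on qubit [k], present because [k] is a neighbour of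
    [j]. *)
Lemma pauliX_stabilizer j k : e j k -> ~~ e k k ->
  on_qubit k X *m graph_stabilizer C e j =
  -1 *: (graph_stabilizer C e j *m on_qubit k X).
Proof.
move=> ejk ekk.
rewrite mulmxA (on_qubit_comm k j (c := 1)) ?scale1r // if_same.
rewrite scale1r -!mulmxA.
rewrite (big_mulmx_comm _ (c := fun l => if k == l then -1 else 1)).
  rewrite -scalemxAr; congr (_ *: _); rewrite (bigD1 k) //= eqxx.
  by rewrite big1 ?mulr1 // => l /andP[_]; rewrite eq_sym => /negPf->.
by move=> l _; apply: on_qubit_comm; apply: pauliXZ_anticomm.
Qed.

Lemma on_qubit_associated_comm mu E (j : 'I_n) (M : 'M[C]_2) :
  associated_with mu E ->
  (forall b, comm_mx M (outcome_proj1 C (mu j) b)) ->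
  comm_mx (on_qubit j M) E.
Proof.
move=> [c ->] cM; apply: comm_mx_sum => o _.
rewrite /comm_mx -scalemxAr -scalemxAl; congr (_ *: _).
rewrite (tensor_comm (c := fun=> 1)) ?big1 ?scale1r // => i.
rewrite scale1r; case: eqP => [->|_]; first exact: cM.
by rewrite mulmx1 mul1mx.
Qed.

End Stabilizer.

(** * Bounding the gap by measurement probabilities *)

Section Gap.
Variables (C : numClosedFieldType) (n m : nat) (e : rel 'I_n).
Variables (psi : 'cV[C]_(qdim n)) (p : 'I_m -> C) (E : 'I_m -> 'M[C]_(qdim n)).
Variable mu : 'I_m -> 'I_n -> xz_meas.
Hypothesis psi_graph : graph_state e psi.
Hypothesis Omega_xz : xz_verification psi p E mu.

(** Treats both Pauli errors at once: only tests in [bad] can detect the error [U], so [U *m psi] is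
    accepted with at least the total weight of the others. *)
Lemma spectral_gap_le_noncomm (U : 'M[C]_(qdim n)) (j : 'I_n)
    (bad : pred 'I_m) :
  U \is unitarymx ->
  U *m graph_stabilizer C e j = -1 *: (graph_stabilizer C e j *m U) ->
  (forall k, ~~ bad k -> comm_mx U (E k)) ->
  spectral_gap (verification_operator p E) <= \sum_(k | bad k) p k.
Proof.
move=> Uu US UE; have [psi1 Spsi] := psi_graph.
have [[p_ge0 p1] Et _] := Omega_xz.
have UU : U ^t* *m U = 1%:M by apply/mulmx1C/unitarymxP.
have SS : (graph_stabilizer C e j) ^t* *m graph_stabilizer C e j = 1%:M.
  exact/mulmx1C/unitarymxP/graph_stabilizer_unitary.
move: (graph_stabilizer C e j) (Spsi j) US SS => S {}Spsi US SS.
set v := U *m psi; set Om := verification_operator p E.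
have v1 : v ^t* *m v = 1%:M.
  by rewrite adjoint_mul -mulmxA (mulmxA _ U) UU mul1mx.
have psiv : psi ^t* *m v = 0.
  (* Inserting the stabilizer on both sides and anticommuting it past [U] negates the overlap. *)
  suff psivN : psi ^t* *m v = - (psi ^t* *m v).
    move: (_ *m v) psivN => r /matrixP rN; apply/matrixP => a b.
    by apply/eqP; move: (rN a b); rewrite !mxE => /eqP; rewrite eq_sym eqNr.
  transitivity ((S *m psi) ^t* *m (U *m (S *m psi))); first by rewrite Spsi.
  rewrite adjoint_mul (mulmxA U) US -!scalemxAl -scalemxAr scaleN1r.
  by congr (- _); rewrite -!mulmxA (mulmxA (S ^t*)) SS mul1mx.
have sum_split : 1 - \sum_(k | bad k) p k = \sum_(k | ~~ bad k) p k.
  by rewrite -p1 (bigID bad) /= addrAC subrr add0r.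
rewrite /spectral_gap lerBlDr -lerBlDl sum_split.
apply: (@second_eigenvalue_ge _ _ _ psi v) => //.
(* The dimension [2 ^ n] exceeds 1 because the qubit [j] exists. *)
- rewrite card_ffun !card_ord -{1}(expn0 2) ltn_exp2l //.
  exact: leq_ltn_trans (ltn_ord j).
- apply/is_hermitianmxP; rewrite expr0 scale1r /Om /verification_operator.
  apply/matrixP => x y; rewrite !mxE !summxE rmorph_sum; apply: eq_bigr => k _.
  have [[/is_hermitianmxP Eh _] _ _] := Et k.
  rewrite !mxE rmorphM /= (CrealP (ger0_real (p_ge0 k))); congr (_ * _).
  by rewrite {1}Eh expr0 scale1r !mxE.
- rewrite mulmx_suml -[RHS]scale1r -p1 scaler_suml; apply: eq_bigr => k _.
  by have [_ _ Epsi] := Et k; rewrite -scalemxAl Epsi.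
- by rewrite -sum_split lerBlDr lerDl sumr_ge0.
(* Bad tests contribute nonnegatively by positivity and are dropped; each other test contributes its
   full weight. *)
rewrite mulmx_sumr mulmx_suml summxE [leRHS](bigID bad) /= ler_wpDl //.
  apply: sumr_ge0 => k _; rewrite -scalemxAr -scalemxAl mxE mulr_ge0 //.
  by have [[_ ->]] := Et k.
apply: ler_sum => k /UE UEk; rewrite -scalemxAr -scalemxAl mxE.
have [_ _ Epsi] := Et k.
by rewrite -mulmxA [E k *m v]mulmxA -UEk -mulmxA Epsi v1 mxE eqxx mulr1.
Qed.

Lemma spectral_gap_le_probX j :
  spectral_gap (verification_operator p E) <= probX p mu j.
Proof.
have [_ _ Emu] := Omega_xz.
apply: (@spectral_gap_le_noncomm (on_qubit j (pauliZ C)) j).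
- exact/on_qubit_unitary/pauliZ_unitary.
- exact: pauliZ_stabilizer.
move=> k muk; apply: (on_qubit_associated_comm (Emu k)) => b.
exact: pauliZ_outcome.
Qed.

Lemma spectral_gap_le_probZ j k : e j k -> ~~ e k k ->
  spectral_gap (verification_operator p E) <= probZ p mu k.
Proof.
move=> ejk ekk; have [_ _ Emu] := Omega_xz.
apply: (@spectral_gap_le_noncomm (on_qubit k (pauliX C)) j).
- exact/on_qubit_unitary/pauliX_unitary.
- exact: pauliX_stabilizer.
move=> l mul; apply: (on_qubit_associated_comm (Emu l)) => b.
exact: pauliX_outcome.
Qed.

(** A setting measures at most one of [X] and [Z] on a qubit; the slack is the weight of settings
    that leave it unmeasured. *)
Lemma probXDprobZ_le1 j : probX p mu j + probZ p mu j <= 1.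
Proof.
have [[p_ge0 p1] _ _] := Omega_xz.
rewrite -p1 (bigID (fun k => measuresX (mu k j))) /= lerD2l.
rewrite [leRHS](bigID (fun k => measuresZ (mu k j))) /=.
rewrite ler_wpDr ?sumr_ge0 //.
rewrite le_eqVlt; apply/orP; left; apply/eqP/eq_bigl => k.
by case: (mu k j).
Qed.

End Gap.

(** The equality case concerns qubits with a neighbour. An isolated qubit is in the [+1] eigenstate
    of [X]: for one edge plus an isolated qubit, measuring [X] on the latter in every test still
    allows gap 1/2. *)
Theorem corollary2 (R : realType) (n : nat) (e : rel 'I_n)
    (psi : 'cV[R[i]]_(qdim n)) (m : nat) (p : 'I_m -> R[i])
    (E : 'I_m -> 'M[R[i]]_(qdim n)) (mu : 'I_m -> 'I_n -> xz_meas)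
    (e_sym : symmetric e) (e_irr : irreflexive e)
    (e_nonempty : exists i j : 'I_n, e i j)
    (psi_graph : graph_state e psi)
    (Omega_xz : xz_verification psi p E mu) :
  spectral_gap (verification_operator p E) <= 1 / 2%:R /\
  (spectral_gap (verification_operator p E) = 1 / 2%:R ->
   forall j : 'I_n, (exists k : 'I_n, e j k) -> probX p mu j = probZ p mu j).
Proof.
have gap_leX := spectral_gap_le_probX psi_graph Omega_xz.
have gap_leZ j k (ejk : e j k) :=
  spectral_gap_le_probZ psi_graph Omega_xz ejk (negbT (e_irr k)).
have XZ_le1 := probXDprobZ_le1 Omega_xz.
set nu := spectral_gap _ in gap_leX gap_leZ *.
split=> [|nuE j [k ejk]].
  have [i [j eij]] := e_nonempty.
  rewrite ler_pdivlMr // mulr_natr mulr2n.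
  exact: le_trans (lerD (gap_leX j) (gap_leZ _ _ eij)) (XZ_le1 j).
have ekj : e k j by rewrite e_sym.
(* Both probabilities are at least [nu] and sum to at most [1 = nu + nu], so each equals [nu]. *)
have half : nu = 1 - nu by apply/eqP; rewrite nuE eq_sym subr_eq -splitr.
have X_ge := gap_leX j; have Z_ge := gap_leZ _ _ ekj; have XZ := XZ_le1 j.
have X_eq : probX p mu j = nu.
  apply/le_anti; rewrite X_ge andbT half lerBrDr.
  by apply: le_trans XZ; rewrite lerD2l.
apply/le_anti; rewrite X_eq Z_ge /= half lerBrDl.
by apply: le_trans XZ; rewrite lerD2r.
Qed.
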